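(* Let $k$ be a field and let $m,n\ge2$ be integers. Then $2\le\operatorname{ms}(k(K_m\vee K_n))\le\min\{m,n\}$.
   Context: $K_m$ denotes the complete graph on $m$ vertices. The wedge $K_m\vee K_n$ is the graph on $m+n-1$ vertices obtained from $K_m$ and $K_n$ by identifying one vertex of $K_m$ with one vertex of $K_n$ (vertex sets meeting in exactly one vertex; the edge set is the union of the two edge sets). For a finite simple graph $G$ on $\{1,\dots,N\}$, the edge ring over $k$ is $k(G)=k[x_1,\dots,x_N]/I(G)$, where $I(G)=(x_ix_j\mid\{i,j\}\text{ is an edge of }G)$; it is standard graded with homogeneous maximal ideal $\bar{\mathfrak m}$ (the image of $(x_1,\dots,x_N)$). For a homogeneous ideal $J$ of $k(G)$, $\mu(J)=\dim_k(J/\bar{\mathfrak m}J)$, and $\operatorname{ms}(k(G))=\min\{\mu(J): J\subseteq \bar{\mathfrak m}\text{ homogeneous with }J\supseteq \bar{\mathfrak m}^2\}$. *)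

(* Defs.v *)
From HB Require Import structures.
From mathcomp Require Import all_boot all_order all_algebra.
From mathcomp Require Import boolp classical_sets.
From mathcomp Require Import mpoly.

Set Implicit Arguments.
Unset Strict Implicit.
Unset Printing Implicit Defensive.

Import GRing.Theory.

Local Open Scope ring_scope.
Local Open Scope quotient_scope.
Local Open Scope classical_set_scope.

(* [symmetric] is qualified because mpoly reuses the name for polynomials. *)
Record sgraph (N : nat) := SGraph {
  adj :> rel 'I_N;
  adj_sym : ssrbool.symmetric adj;
  adj_irr : irreflexive adj
}.

Definition complete_on (N : nat) (A : pred 'I_N) : rel 'I_N :=
  fun i j => [&& i != j, A i & A j].

(* For m, n >= 1, K_m lives on {0, ..., m - 1} and K_n on
   {m - 1, ..., m + n - 2}; the vertex sets meet exactly in m - 1. *)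
Definition wedge_adj (m n : nat) : rel 'I_(m + n - 1) :=
  relU (complete_on (fun i => (i < m)%N))
       (complete_on (fun i => (m - 1 <= i)%N)).

Lemma wedge_adj_sym m n : ssrbool.symmetric (@wedge_adj m n).
Proof.
move=> i j; rewrite /wedge_adj /complete_on /= eq_sym.
by congr (_ || _); congr (_ && _); rewrite andbC.
Qed.

Lemma wedge_adj_irr m n : irreflexive (@wedge_adj m n).
Proof. by move=> i; rewrite /wedge_adj /complete_on /= eqxx. Qed.

Definition wedge_complete (m n : nat) : sgraph (m + n - 1) :=
  SGraph (@wedge_adj_sym m n) (@wedge_adj_irr m n).

Section Ideals.
Variable A : comNzRingType.

Definition ideal_gen (S : set A) : set A :=
  [set x | exists s : seq (A * A),
     (forall p, p \in s -> S p.2) /\ x = \sum_(p <- s) p.1 * p.2].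

Definition ideal_mul (I J : set A) : set A :=
  ideal_gen [set x * y | x in I & y in J].

End Ideals.

(* dim_k (U / W) = d, for subspaces W `<=` U of V: some d elements of U map to
   a basis of U / W. *)
Definition has_quot_dim (k : fieldType) (V : lmodType k) (U W : set V)
    (d : nat) : Prop :=
  exists b : 'I_d -> V, (forall i, U (b i)) /\
    forall x, U x ->
      exists! c : {ffun 'I_d -> k}, W (x - \sum_(i < d) c i *: b i).

Section EdgeRing.
Variables (k : fieldType) (N : nat) (G : sgraph N).

Definition edge_monomials : set {mpoly k[N]} :=
  [set p | exists i j : 'I_N, G i j /\ p = 'X_i * 'X_j].

Definition edge_ideal : {pred {mpoly k[N]}} :=
  fun p => `[< ideal_gen edge_monomials p >].

Lemma edge_ideal_closed : idealr_closed edge_ideal.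
Proof.
split.
- by apply/asboolP; exists [::]; rewrite big_nil.
- apply/negP => /asboolP [s [sE /(congr1 (meval (fun=> 0)))]].
  rewrite rmorph1 rmorph_sum /= big_seq big1 => [/eqP|p /sE [i [j [_ ->]]]].
    by rewrite oner_eq0.
  by rewrite !rmorphM /= mevalXU mul0r mulr0.
- move=> a u v /asboolP [s [sE ->]] /asboolP [t [tE ->]].
  apply/asboolP; exists ([seq (a * p.1, p.2) | p <- s] ++ t); split.
    move=> p; rewrite mem_cat => /orP [/mapP [q /sE qE ->]|/tE] //.
  rewrite big_cat big_map mulr_sumr; congr (_ + _).
  by apply: eq_bigr => p _; rewrite mulrA.
Qed.

HB.instance Definition _ :=
  isIdealr.Build {mpoly k[N]} edge_ideal edge_ideal_closed.

Definition edge_ring : Type := {ideal_quot edge_ideal}.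

HB.instance Definition _ := GRing.ComNzRing.on edge_ring.

Definition edge_proj (p : {mpoly k[N]}) : edge_ring :=
  \pi_({ideal_quot edge_ideal}) p.

Lemma edge_proj_is_zmod_morphism : zmod_morphism edge_proj.
Proof. exact: raddfB. Qed.

Lemma edge_proj_is_monoid_morphism : monoid_morphism edge_proj.
Proof. by split; [exact: rmorph1 | exact: rmorphM]. Qed.

HB.instance Definition _ := GRing.isZmodMorphism.Build {mpoly k[N]} edge_ring
  edge_proj edge_proj_is_zmod_morphism.
HB.instance Definition _ := GRing.isMonoidMorphism.Build {mpoly k[N]} edge_ring
  edge_proj edge_proj_is_monoid_morphism.

Definition edge_scale (c : k) (x : edge_ring) : edge_ring :=
  edge_proj c%:MP * x.

Fact edge_scaleA a b x : edge_scale a (edge_scale b x) = edge_scale (a * b) x.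
Proof. by rewrite /edge_scale mulrA -rmorphM -mpolyCM. Qed.

Fact edge_scale1 : left_id 1 edge_scale.
Proof. by move=> x; rewrite /edge_scale mpolyC1 rmorph1 mul1r. Qed.

Fact edge_scaleDr : right_distributive edge_scale +%R.
Proof. by move=> a x y; rewrite /edge_scale mulrDr. Qed.

Fact edge_scaleDl x : {morph edge_scale^~ x : a b / a + b}.
Proof. by move=> a b; rewrite /edge_scale mpolyCD rmorphD mulrDl. Qed.

HB.instance Definition _ := GRing.Zmodule_isLmodule.Build k edge_ring
  edge_scaleA edge_scale1 edge_scaleDr edge_scaleDl.

Definition edge_max : set edge_ring :=
  ideal_gen [set edge_proj 'X_i | i in [set: 'I_N]].

Definition edge_homog : set edge_ring :=
  [set x | exists d (p : {mpoly k[N]}), p \is d.-homog /\ x = edge_proj p].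

Definition homog_ideal (J : set edge_ring) : Prop :=
  exists2 S : set edge_ring, S `<=` edge_homog & J = ideal_gen S.

Definition has_mu (J : set edge_ring) (d : nat) : Prop :=
  has_quot_dim J (ideal_mul edge_max J) d.

Definition ms_values : set nat :=
  [set d | exists J : set edge_ring,
     [/\ homog_ideal J, J `<=` edge_max, ideal_mul edge_max edge_max `<=` J
       & has_mu J d]].

(* The minimum of [ms_values]; the default 0 is taken only if [ms_values] were
   empty. *)
Definition ms : nat :=
  xget 0%N [set r | ms_values r /\ forall d, ms_values d -> (r <= d)%N].

End EdgeRing.

(* Main.v *)
(* The tools are the evaluations x_i |-> c_i t into k[t], which kill I(G) as soon
   as c_i c_j = 0 on every edge.
   Lower bound, for any graph with nonadjacent vertices i != j: if mu(J) <= 1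
   then J = (f) + mJ, hence J lies in (f) + m^3, and x_i^2 and x_j^2 are both
   multiples of f modulo m^3. Evaluating on the plane spanned by the i-th and
   j-th coordinates shows that f has no linear part there, and then that x_i^2
   and x_j^2 would be proportional.
   Upper bound, for any clique A: J generated by the x_i, i outside A, and by
   s = sum_(i in A) x_i contains m^2, because x_i^2 = x_i s for i in A; its
   N - |A| + 1 generators are independent modulo m^2. Taking for A each of the
   two complete graphs gives m and n. *)
Require Import Defs.
From HB Require Import structures.
From mathcomp Require Import all_boot all_order all_algebra.
From mathcomp Require Import boolp classical_sets.
From mathcomp Require Import mpoly.
From mathcomp Require Import zify.

Set Implicit Arguments.
Unset Strict Implicit.
Unset Printing Implicit Defensive.

Import GRing.Theory.

Local Open Scope ring_scope.
Local Open Scope quotient_scope.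
Local Open Scope classical_set_scope.

(** * Membership in generated ideals and in products of ideals *)

Section IdealSets.
Variable A : comNzRingType.
Implicit Types (S T I J : set A).

Definition ideal_set T : Prop :=
  [/\ T 0, forall x y, T x -> T y -> T (x + y) & forall a x, T x -> T (a * x)].

Lemma ideal_set_sum T (I : Type) (r : seq I) (P : pred I) (F : I -> A) :
  ideal_set T -> (forall i, P i -> T (F i)) -> T (\sum_(i <- r | P i) F i).
Proof. by case=> T0 TD _ TF; apply: (big_ind T). Qed.

Lemma ideal_gen_set S : ideal_set (ideal_gen S).
Proof.
split.
- by exists [::]; split=> //; rewrite big_nil.
- move=> _ _ [s [sS ->]] [t [tS ->]]; exists (s ++ t); split.
    by move=> p; rewrite mem_cat => /orP[/sS|/tS].
  by rewrite big_cat.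
- move=> a _ [s [sS ->]]; exists [seq (a * p.1, p.2) | p <- s]; split.
    by move=> _ /mapP[q /sS qS ->].
  by rewrite big_map mulr_sumr; apply: eq_bigr => p _; rewrite mulrA.
Qed.

Lemma mem_ideal_gen S x : S x -> ideal_gen S x.
Proof.
move=> Sx; exists [:: (1, x)]; split; last by rewrite big_seq1 mul1r.
by move=> p; rewrite inE => /eqP->.
Qed.

Lemma ideal_gen_sub S T : ideal_set T -> S `<=` T -> ideal_gen S `<=` T.
Proof.
move=> idT ST _ [s [sS ->]]; rewrite big_seq; apply: ideal_set_sum => // p ps.
by case: idT => _ _ TM; apply/TM/ST/sS.
Qed.

Lemma mem_ideal_mul I J x y : I x -> J y -> ideal_mul I J (x * y).
Proof. by move=> Ix Jy; apply: mem_ideal_gen; exists x => //; exists y. Qed.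

Lemma ideal_mul_sub I J T :
  ideal_set T -> (forall x y, I x -> J y -> T (x * y)) -> ideal_mul I J `<=` T.
Proof.
by move=> idT TM; apply: ideal_gen_sub => // _ [x Ix [y Jy <-]]; apply: TM.
Qed.

(** With one factor fixed, the other factors whose product lies in [T] form an ideal. Applying this
    to each factor in turn reduces the inclusion to generators. *)
Lemma ideal_gen_mul_sub (S1 S2 T : set A) : ideal_set T ->
  (forall x y, S1 x -> S2 y -> T (x * y)) ->
  ideal_mul (ideal_gen S1) (ideal_gen S2) `<=` T.
Proof.
move=> idT TM; have [T0 TD TZ] := idT; apply: ideal_mul_sub => // x y Ix Jy.
move: x Ix; apply: ideal_gen_sub => [|x Sx].
  by split=> [|u v Tu Tv|a u Tu]; rewrite ?mul0r // ?mulrDl -?mulrA; auto.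
move: y Jy; apply: ideal_gen_sub => [|y Sy]; last exact: TM.
by split=> [|u v Tu Tv|a u Tu]; rewrite ?mulr0 // ?mulrDr 1?mulrCA; auto.
Qed.

End IdealSets.

(** * Induction on multivariate polynomials; low coefficients of a product *)

Lemma mpoly_alg_ind (R : comNzRingType) (N : nat) (P : {mpoly R[N]} -> Prop) :
  (forall c, P c%:MP) -> (forall i, P 'X_i) ->
  (forall p q, P p -> P q -> P (p + q)) ->
  (forall p q, P p -> P q -> P (p * q)) -> forall p, P p.
Proof.
move=> PC PX PD PM p; rewrite [p]mpolyE; apply: big_ind => //.
  by rewrite -mpolyC0.
move=> m _; rewrite -mul_mpolyC; apply: (PM) => //.
rewrite mpolyXE_id; apply: big_ind => [||i _]; rewrite -?mpolyC1 //.
by elim: (m i) => [|d IH]; rewrite ?expr0 -?mpolyC1 // exprS; apply: PM.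
Qed.

Lemma coefpM0 (R : nzRingType) (p q : {poly R}) : (p * q)`_0 = p`_0 * q`_0.
Proof. by rewrite coefM big_ord1. Qed.

Lemma coefpM1 (R : nzRingType) (p q : {poly R}) :
  (p * q)`_1 = p`_0 * q`_1 + p`_1 * q`_0.
Proof. by rewrite coefM big_ord_recr big_ord1. Qed.

Lemma coefpM2 (R : nzRingType) (p q : {poly R}) :
  (p * q)`_2 = p`_0 * q`_2 + p`_1 * q`_1 + p`_2 * q`_0.
Proof. by rewrite coefM !big_ord_recr big_ord0 /= add0r. Qed.

Lemma dvd_Xn_coef (F : fieldType) n (p : {poly F}) i :
  (i < n)%N -> 'X^n %| p -> p`_i = 0.
Proof. by move=> lt_in /dvdpP[q ->]; rewrite coefMXn lt_in. Qed.

(** * Evaluation of the edge ring along lines through the origin *)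

Section LineEval.
Variables (k : fieldType) (N : nat) (G : sgraph N).
Local Notation R := (edge_ring k G).
Local Notation proj := (@edge_proj k N G).
Implicit Types (c : 'I_N -> k) (x y : R).

Definition line_eval c (p : {mpoly k[N]}) : {poly k} :=
  mmap (@polyC k) (fun i => c i *: 'X) p.

HB.instance Definition _ c :=
  GRing.RMorphism.copy (line_eval c) (mmap (@polyC k) (fun i => c i *: 'X)).

Lemma line_evalC c a : line_eval c a%:MP = a%:P.
Proof. exact: mmapC. Qed.

Lemma line_evalX c i : line_eval c 'X_i = c i *: 'X.
Proof. by rewrite /line_eval mmapX mmap1U. Qed.

(** Both sides are the constant term of [p]: all these lines pass through the origin. *)
Lemma line_eval_coef0 c c' p : (line_eval c p)`_0 = (line_eval c' p)`_0.
Proof.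
elim/mpoly_alg_ind: p => [a|i|p q IHp IHq|p q IHp IHq].
- by rewrite !line_evalC.
- by rewrite !line_evalX !coefZ !coefX !mulr0.
- by rewrite !rmorphD !coefD IHp IHq.
- by rewrite !rmorphM !coefpM0 IHp IHq.
Qed.

(** The factor next to [c i] is the coefficient of ['X_i] in [p], so the coefficient of t is a
    linear form in [c]. For products this is the Leibniz rule, with constant terms that do not
    depend on [c]. *)
Lemma line_eval_coef1 c p :
  (line_eval c p)`_1 = \sum_i c i * (line_eval (fun j => (j == i)%:R) p)`_1.
Proof.
elim/mpoly_alg_ind: p => [a|i|p q IHp IHq|p q IHp IHq].
- rewrite line_evalC coefC big1 // => i _.
  by rewrite line_evalC coefC mulr0.
- rewrite line_evalX coefZ coefX mulr1 (bigD1 i) //= line_evalX eqxx coefZ.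
  rewrite coefX !mulr1 big1 ?addr0 // => j ji.
  by rewrite line_evalX eq_sym (negPf ji) scale0r coef0 mulr0.
- rewrite !rmorphD !coefD IHp IHq -big_split; apply: eq_bigr => i _ /=.
  by rewrite rmorphD coefD mulrDr.
- rewrite !rmorphM !coefpM1 IHp IHq mulr_sumr mulr_suml -big_split.
  apply: eq_bigr => i _ /=; rewrite rmorphM coefpM1 mulrDr !mulrA.
  by rewrite (line_eval_coef0 c (fun j => (j == i)%:R))
             (line_eval_coef0 c (fun j => (j == i)%:R) q) (mulrC _ (c i)).
Qed.

(** These are the zeros of I(G). The condition is homogeneous, so the whole line through [c]
    consists of zeros and evaluation along it descends to the edge ring. *)
Definition edge_free c : Prop := forall i j, G i j -> c i * c j = 0.

Lemma line_eval_edge_ideal c p :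
  edge_free c -> p \in edge_ideal G -> line_eval c p = 0.
Proof.
move=> cG /asboolP; move: p.
apply: ideal_gen_sub => [|_ [i [j [Gij ->]]]]; last first.
  by rewrite rmorphM /= !line_evalX -scalerAl -scalerAr scalerA cG ?scale0r.
split=> [|p q p0 q0|a p p0] /=; first by rewrite rmorph0.
  by rewrite rmorphD /= p0 q0 addr0.
by rewrite rmorphM /= p0 mulr0.
Qed.

(** Choosing a representative makes this total in [c], with no proof of [edge_free] as argument; for
    edge-free [c] the choice does not matter. *)
Definition edge_eval c x : {poly k} := line_eval c (repr x).

Lemma edge_evalE c p : edge_free c -> edge_eval c (proj p) = line_eval c p.
Proof.
move=> cG; apply/eqP; rewrite -subr_eq0 -rmorphB /= line_eval_edge_ideal //.
by rewrite Quotient.idealrBE reprK.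
Qed.

Lemma edge_projK x : proj (repr x) = x. Proof. exact: reprK. Qed.

Lemma edge_projP x : exists p, x = proj p.
Proof. by exists (repr x); rewrite edge_projK. Qed.

Section EdgeFree.
Variables (c : 'I_N -> k) (cG : edge_free c).

Lemma edge_eval0 : edge_eval c 0 = 0.
Proof. by rewrite -(rmorph0 proj) edge_evalE // rmorph0. Qed.

Lemma edge_evalD : {morph edge_eval c : x y / x + y}.
Proof.
move=> x y; have [[p ->] [q ->]] := (edge_projP x, edge_projP y).
by rewrite -rmorphD !edge_evalE ?rmorphD.
Qed.

Lemma edge_evalM : {morph edge_eval c : x y / x * y}.
Proof.
move=> x y; have [[p ->] [q ->]] := (edge_projP x, edge_projP y).
by rewrite -rmorphM !edge_evalE ?rmorphM.
Qed.

Lemma edge_evalN : {morph edge_eval c : x / - x}.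
Proof.
move=> x; have [p ->] := edge_projP x.
by rewrite -rmorphN !edge_evalE ?rmorphN.
Qed.

Lemma edge_evalX i : edge_eval c (proj 'X_i) = c i *: 'X.
Proof. by rewrite edge_evalE ?line_evalX. Qed.

Lemma edge_evalZ a x : edge_eval c (a *: x) = a *: edge_eval c x.
Proof.
rewrite [a *: x]/(proj a%:MP * x) edge_evalM edge_evalE //.
by rewrite line_evalC mul_polyC.
Qed.

(** This preimage of the ideal (t^n) of k[t] stands in for the n-th power of the maximal ideal. *)
Lemma dvd_edge_eval_ideal n : ideal_set [set x | 'X^n %| edge_eval c x].
Proof.
split=> [|x y /= dx dy|a x /= dx]; first by rewrite /= edge_eval0 dvdp0.
  by rewrite edge_evalD dvdp_add.
by rewrite edge_evalM dvdp_mull.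
Qed.

Lemma dvd_edge_max x : edge_max x -> 'X %| edge_eval c x.
Proof.
move: x; have := dvd_edge_eval_ideal 1; rewrite expr1 => idX.
by apply: ideal_gen_sub => // _ [i _ <-] /=; rewrite edge_evalX -mul_polyC dvdp_mull.
Qed.

End EdgeFree.
End LineEval.

(** * Lower bound from two nonadjacent vertices *)

Section LowerBound.
Variables (k : fieldType) (N : nat) (G : sgraph N).
Local Notation R := (edge_ring k G).
Local Notation proj := (@edge_proj k N G).

(* If J = (f) + mJ then J is contained in (f) + m^(n+1) for all n; only the image
   of this inclusion under the evaluations is recorded. *)
Lemma principal_mod_max (J : set R) (f : R) (n : nat) :
  J `<=` @edge_max k N G ->
  (forall x, J x -> exists a, ideal_mul (@edge_max k N G) J (x - a * f)) ->
  forall x, J x ->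
    exists g, forall c, edge_free G c -> 'X^(n.+1) %| edge_eval c (x - g * f).
Proof.
move=> Jm Jf; elim: n => [|n IHn] x Jx.
  by exists 0 => c cG; rewrite mul0r subr0 expr1 dvd_edge_max //; apply: Jm.
pose T : set R := fun y =>
  exists g, forall c, edge_free G c -> 'X^(n.+2) %| edge_eval c (y - g * f).
have idT : ideal_set T.
  split=> [|y z [g dg] [h dh]|a y [g dg]].
  - by exists 0 => c cG; rewrite mul0r subr0 edge_eval0 // dvdp0.
  - exists (g + h) => c cG; rewrite mulrDl opprD addrACA edge_evalD //.
    by rewrite dvdp_add ?dg ?dh.
  - exists (a * g) => c cG; rewrite -mulrA -mulrBr edge_evalM //.
    by rewrite dvdp_mull ?dg.
have mJT : ideal_mul (@edge_max k N G) J `<=` T.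
  apply: ideal_mul_sub => // y z my Jz; have [g dg] := IHn z Jz.
  exists (y * g) => c cG; rewrite -mulrA -mulrBr edge_evalM // exprS.
  by rewrite dvdp_mul ?dg ?dvd_edge_max.
have [a /mJT[g dg]] := Jf x Jx.
by exists (a + g) => c cG; rewrite mulrDl opprD addrA dg.
Qed.

Lemma ms_values_ge2 (i j : 'I_N) (d : nat) :
  i != j -> ~~ G i j -> ms_values k G d -> (2 <= d)%N.
Proof.
move=> ij nGij [J [_ Jm mmJ [b [bJ Jb]]]]; rewrite leqNgt; apply/negP => d_lt2.
(* For [d = 0] the quotient J/mJ vanishes and [f = 0] serves; for [d = 1] the single basis element
   does. *)
have [f fm Jf] : exists2 f : R, edge_max f &
    forall x, J x -> exists a, ideal_mul (@edge_max k N G) J (x - a * f).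
  case: d d_lt2 b bJ Jb => [|[|//]] _ b bJ Jb.
    have [m0 _ _] := ideal_gen_set [set proj 'X_i | i in [set: 'I_N]].
    exists 0 => // x /Jb[c [cx _]]; exists 0; rewrite mulr0.
    by rewrite big_ord0 in cx.
  exists (b ord0) => [|x /Jb[c [cx _]]]; first exact/Jm/bJ.
  by exists (proj (c ord0)%:MP); rewrite big_ord1 in cx.
(* The plane of the i-th and j-th coordinates is edge-free, because its points are supported on two
   nonadjacent vertices. *)
pose pt (u v : k) (l : 'I_N) := if l == i then u else if l == j then v else 0.
have ptG u v : edge_free G (pt u v).
  have aux l : pt u v l != 0 -> (l == i) || (l == j).
    by rewrite /pt; case: (l == i); case: (l == j); rewrite // eqxx.
  move=> l l' Gll'; apply/eqP; rewrite mulf_eq0; apply/norP => -[/aux + /aux].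
  by move=> /orP[]/eqP El /orP[]/eqP El'; move: Gll' nGij;
    rewrite El El' ?adj_irr // 1?adj_sym => ->.
have f0 u v : (edge_eval (pt u v) f)`_0 = 0.
  have := dvd_edge_max (ptG u v) fm; rewrite -['X]expr1.
  exact: dvd_Xn_coef.
have [al [be f1]] : exists al be, forall u v,
    (edge_eval (pt u v) f)`_1 = u * al + v * be.
  exists (edge_eval (fun l => (l == i)%:R) f)`_1.
  exists (edge_eval (fun l => (l == j)%:R) f)`_1 => u v.
  rewrite /edge_eval line_eval_coef1 (bigD1 i) //= (bigD1 j) 1?eq_sym //=.
  rewrite big1 ?addr0 => [|l /andP[li lj]].
    by rewrite /pt !eqxx eq_sym (negPf ij).
  by rewrite /pt (negPf li) (negPf lj) mul0r.
(* Write x_l^2 = g f modulo t^3 and compare the coefficients of t and t^2. The constant term [g0] of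
   g is the same at every point, hence chosen before [u] and [v]; the linear term [g1] depends on
   the point. *)
have sq l : exists g0 : k, forall u v, exists g1 : k,
    g0 * (u * al + v * be) = 0 /\
    pt u v l ^+ 2 = g0 * (edge_eval (pt u v) f)`_2 + g1 * (u * al + v * be).
  have sqJ : J (proj 'X_l * proj 'X_l).
    by apply/mmJ/mem_ideal_mul; apply: mem_ideal_gen; exists l.
  have [g dg] := principal_mod_max 2 Jm Jf sqJ.
  exists (edge_eval (fun=> 0) g)`_0 => u v; exists (edge_eval (pt u v) g)`_1.
  have cE r : (r < 3)%N -> (edge_eval (pt u v) (proj 'X_l * proj 'X_l))`_r =
                           (edge_eval (pt u v) g * edge_eval (pt u v) f)`_r.
    move=> /dvd_Xn_coef/(_ (dg _ (ptG u v))).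
    rewrite edge_evalD // edge_evalN // (edge_evalM _ g) // coefB.
    by move/eqP; rewrite subr_eq0 => /eqP.
  rewrite -f1 /edge_eval (line_eval_coef0 _ (pt u v)) -!/(edge_eval _ _).
  have := (cE 1 isT, cE 2 isT).
  rewrite edge_evalM // !edge_evalX // -scalerAl -scalerAr scalerA -(expr2 'X) -expr2.
  rewrite !coefZ !coefXn coefpM1 coefpM2 f0 /= !mulr0 !addr0 mulr1.
  by case=> <- <-.
have pti u v : pt u v i = u by rewrite /pt eqxx.
have ptj u v : pt u v j = v by rewrite /pt eqxx eq_sym (negPf ij).
have [[g0 gE] [h0 hE]] := (sq i, sq j).
(* The linear part of f vanishes at (be, - al), so x_i^2 and x_j^2 would vanish
   there as well if it were nonzero. *)
have lin0 : be * al + - al * be = 0 by rewrite mulNr mulrC subrr.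
have be0 : be = 0.
  have [_ [+ _]] := gE 0 1; rewrite mul0r mul1r add0r => g0be.
  have [g1 [_ +]] := gE be (- al); rewrite pti lin0 mulr0 addr0.
  (* Since [g0 * be = 0], multiplying by [be] leaves [be ^+ 3 = 0]. *)
  move=> /(congr1 (fun y => be * y)).
  by rewrite mulrA (mulrC be g0) g0be mul0r -exprS => /eqP;
    rewrite expf_eq0 /= => /eqP.
have al0 : al = 0.
  have [_ [+ _]] := hE 1 0; rewrite mul0r mul1r addr0 => h0al.
  have [h1 [_ +]] := hE be (- al); rewrite ptj lin0 mulr0 addr0 sqrrN.
  move=> /(congr1 (fun y => al * y)).
  by rewrite mulrA (mulrC al h0) h0al mul0r -exprS => /eqP;
    rewrite expf_eq0 /= => /eqP.
(* With no linear part left, let q be the t^2 coefficient of [f]. Then 1 = g0 q(1,0), 0 = h0 q(1,0)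
   and 1 = h0 q(0,1), which is impossible in a field. *)
have [g1 [_ g10]] := gE 1 0.
have [[h1 [_ h10]] [h2 [_ h01]]] := (hE 1 0, hE 0 1).
move: g10 h10 h01; rewrite !(pti, ptj) al0 be0 !(mulr0, addr0) expr1n.
move=> g10 /esym/eqP; rewrite expr0n mulf_eq0 => /orP[]/eqP E0.
  by rewrite E0 mul0r => /eqP; rewrite oner_eq0.
by move/eqP: g10; rewrite E0 mulr0 oner_eq0.
Qed.
End LowerBound.

(** * Upper bound from a clique *)

Section UpperBound.
Variables (k : fieldType) (N : nat) (G : sgraph N).
Local Notation R := (edge_ring k G).
Local Notation proj := (@edge_proj k N G).
Local Notation mm := (@edge_max k N G).

Lemma edge_proj_edge i j : G i j -> proj 'X_i * proj 'X_j = 0.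
Proof.
move=> Gij; rewrite -rmorphM -(rmorph0 proj); apply/eqP.
rewrite -[_ == _]Quotient.idealrBE subr0; apply/asboolP.
by apply: mem_ideal_gen; exists i, j.
Qed.

(** The decomposition of the ring as k + m lets ring coefficients be replaced by scalars modulo
    mJ. *)
Lemma edge_max_const (x : R) : exists c : k, mm (x - proj c%:MP).
Proof.
have [m0 mD mM] := ideal_gen_set [set proj 'X_i | i in [set: 'I_N]].
have [p ->] := edge_projP x.
elim/mpoly_alg_ind: p => [c|i|p q [c mc] [d md]|p q [c mc] [d md]].
- by exists c; rewrite subrr.
- by exists 0; rewrite mpolyC0 rmorph0 subr0; apply: mem_ideal_gen; exists i.
- by exists (c + d); rewrite mpolyCD !rmorphD opprD addrACA; apply: mD.
- exists (c * d); rewrite mpolyCM !rmorphM.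
  have -> : proj p * proj q - proj c%:MP * proj d%:MP =
     proj q * (proj p - proj c%:MP) + proj c%:MP * (proj q - proj d%:MP).
    by rewrite !mulrBr addrA (mulrC (proj c%:MP) (proj q)) subrK (mulrC (proj p)).
  by apply: mD; apply: mM.
Qed.

Section Clique.
Variables (A : {set 'I_N}) (a0 : 'I_N).
Hypotheses (a0A : a0 \in A) (cliqueA : {in A &, forall i j, i != j -> G i j}).

(** [B] indexes the generators of [J]: [a0] stands for the sum over the clique, the other indices
    are the vertices outside [A]. *)
Let B : {set 'I_N} := a0 |: ~: A.

Let gen (v : 'I_N) : {mpoly k[N]} :=
  if v == a0 then \sum_(i in A) 'X_i else 'X_v.

Let J : set R := ideal_gen [set proj (gen v) | v in [set v | v \in B]].

Let J_gen v : v \in B -> J (proj (gen v)).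
Proof. by move=> vB; apply: mem_ideal_gen; exists v. Qed.

(** On products of two variables: a vertex outside [A] contributes a generator of [J], distinct
    vertices of [A] give 0, and a square is the variable times the clique sum. *)
Let mmmJ : ideal_mul mm mm `<=` ideal_mul mm J.
Proof.
have X_max u : mm (proj 'X_u) by apply: mem_ideal_gen; exists u.
have X_J u : u \notin A -> J (proj 'X_u).
  move=> uA; have -> : 'X_u = gen u.
    by rewrite /gen; case: eqP uA => // ->; rewrite a0A.
  by apply: J_gen; rewrite !inE uA orbT.
apply: ideal_gen_mul_sub => [|_ _ [u _ <-] [w _ <-]]; first exact: ideal_gen_set.
have [uA|uA] := boolP (u \in A); last first.
  by rewrite mulrC; apply: mem_ideal_mul => //; apply: X_J.
have [wA|wA] := boolP (w \in A); last by apply: mem_ideal_mul => //; apply: X_J.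
have [<-|uw] := eqVneq u w; last first.
  rewrite edge_proj_edge ?cliqueA //.
  by have [] := ideal_gen_set [set x * y | x in mm & y in J].
have -> : proj 'X_u * proj 'X_u = proj 'X_u * proj (gen a0).
  rewrite /gen eqxx rmorph_sum /= (bigD1 u) //= mulrDr mulr_sumr big1 ?addr0 //.
  by move=> i /andP[iA iu]; rewrite edge_proj_edge // cliqueA // eq_sym.
by apply: mem_ideal_mul => //; apply: J_gen; rewrite !inE eqxx.
Qed.

Let Jm : J `<=` mm.
Proof.
have idm := ideal_gen_set [set proj 'X_i | i in [set: 'I_N]].
have X_max u : mm (proj 'X_u) by apply: mem_ideal_gen; exists u.
apply: ideal_gen_sub => // _ [v _ <-]; rewrite /gen; case: eqP => // _.
by rewrite rmorph_sum; apply: ideal_set_sum => // i _; apply: X_max.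
Qed.

(** The coefficient of ['X_v] in the linear part of [x]; a coordinate axis is edge-free because the
    graph has no loops. *)
Let coord (v : 'I_N) (x : R) : k := (edge_eval (fun i => (i == v)%:R) x)`_1.

Let coord_free v : @edge_free k N G (fun i => (i == v)%:R).
Proof.
move=> i j; have [->|] := eqVneq i v; last by rewrite mul0r.
by have [->|] := eqVneq j v; rewrite ?mulr0 // adj_irr.
Qed.

(** The coordinates are dual to the generators: [a0] is the only index of [B] inside [A], so no
    other coordinate from [B] sees the clique sum. *)
Let coord_gen v w : v \in B -> w \in B -> coord v (proj (gen w)) = (v == w)%:R.
Proof.
have coordX u i : coord u (proj 'X_i) = (i == u)%:R.
  by rewrite /coord edge_evalX // coefZ coefX mulr1.
rewrite /gen !inE => vB; have [-> _|wa0 _] := eqVneq w a0; last first.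
  by rewrite coordX eq_sym.
rewrite /coord edge_evalE // rmorph_sum coef_sum /=.
under eq_bigr do rewrite line_evalX coefZ coefX mulr1.
have [vA|vA] := boolP (v \in A).
  rewrite (bigD1 v) //= eqxx big1 ?addr0; last by move=> i /andP[_ /negPf->].
  by move: vB; rewrite vA orbF => ->.
rewrite big1; last by move=> i iA; case: eqP iA vA => // -> ->.
by case: eqP a0A vA => // -> ->.
Qed.

(** As J lies in m, mJ lies in m^2 and has no linear part. *)
Let coord_mJ v x : ideal_mul mm J x -> coord v x = 0.
Proof.
move=> mJx; suff: 'X^2 %| edge_eval (fun i => (i == v)%:R) x.
  exact: dvd_Xn_coef.
move: x mJx; apply: ideal_mul_sub => [|x y mx /Jm my].
  exact: dvd_edge_eval_ideal.
by rewrite /= edge_evalM // dvdp_mul // dvd_edge_max.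
Qed.

(** Scalar coefficients exist because the ring is k + m, and they are unique because [coord]
    recovers them modulo mJ. *)
Lemma clique_has_mu : has_mu J #|B|.
Proof.
pose b (i : 'I_#|B|) : R := proj (gen (enum_val i)).
have Jb i : J (b i) by apply/J_gen/enum_valP.
have idJ : ideal_set J by exact: ideal_gen_set.
have idmJ : ideal_set (ideal_mul mm J) by exact: ideal_gen_set.
have [[J0 JD JM] [mJ0 mJD mJM]] := (idJ, idmJ).
exists b; split=> // x Jx.
have [c cx] : exists c : {ffun 'I_#|B| -> k},
    ideal_mul mm J (x - \sum_i c i *: b i).
  move: x Jx; apply: ideal_gen_sub => [|_ [v vB <-]]; first split.
  - exists 0; rewrite big1 ?subr0 // => i _.
    by rewrite ffunE scale0r.
  - move=> x y [c cx] [d dy]; exists (c + d).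
    under eq_bigr do rewrite ffunE scalerDl.
    by rewrite big_split opprD addrACA; apply: mJD.
  - move=> a x [c cx]; have [e ae] := edge_max_const a.
    exists [ffun i => e * c i].
    under eq_bigr do rewrite ffunE -scalerA.
    rewrite -scaler_sumr; set s := \sum_i _ in cx *.
    (* The second summand lies in mJ, since [a] differs from the scalar [e] by an element of m and
       [s] lies in J. *)
    have -> : a * x - e *: s = a * (x - s) + (a - proj e%:MP) * s.
      by rewrite mulrBr mulrBl addrA subrK.
    apply: mJD; first exact: mJM.
    by apply: mem_ideal_mul => //; apply: ideal_set_sum => // i _; apply: JM.
  - exists [ffun i => (i == enum_rank_in vB v)%:R].
    rewrite (bigD1 (enum_rank_in vB v)) //= ffunE eqxx scale1r.
    rewrite /b enum_rankK_in // big1 ?addr0 ?subrr // => i /negPf iv.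
    by rewrite ffunE iv scale0r.
have cE (d : {ffun 'I_#|B| -> k}) : ideal_mul mm J (x - \sum_i d i *: b i) ->
    forall i, d i = coord (enum_val i) x.
  move=> dx i; apply/esym/eqP; rewrite -subr_eq0; apply/eqP.
  rewrite -(coord_mJ (enum_val i) dx) /coord edge_evalD // edge_evalN // coefB.
  congr (_ - _).
  rewrite (big_morph _ (edge_evalD (coord_free _)) (edge_eval0 _)) //.
  rewrite coef_sum (bigD1 i) //= edge_evalZ // coefZ.
  rewrite [X in _ * X]coord_gen ?enum_valP // eqxx mulr1 big1 ?addr0 // => j ji.
  rewrite edge_evalZ // coefZ [X in _ * X]coord_gen ?enum_valP //.
  by rewrite (inj_eq enum_val_inj) eq_sym (negPf ji) mulr0.
exists c; split=> // d /cE dE; apply/ffunP => i.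
by rewrite dE (cE c cx).
Qed.

Lemma clique_ms_values : ms_values k G (N - #|A|).+1.
Proof.
have <- : #|B| = (N - #|A|).+1.
  by rewrite cardsU1 !inE a0A /= cardsCs finset.setCK card_ord.
have [_ _ JM] := ideal_gen_set [set proj (gen v) | v in [set v | v \in B]].
exists J; split=> //; last exact: clique_has_mu.
- exists [set proj (gen v) | v in [set v | v \in B]] => // _ [v _ <-].
  exists 1%N, (gen v); split=> //; rewrite /gen; case: ifP => _.
    by apply: rpred_sum => i _; rewrite dhomogX /= mdeg1.
  by rewrite dhomogX /= mdeg1.
- apply: (subset_trans mmmJ); apply: ideal_mul_sub => [|x y _ Jy].
    exact: ideal_gen_set.
  exact: JM.
Qed.

End Clique.
End UpperBound.

(** * Attaining the minimum, and the two cliques of the wedge *)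

Lemma ms_min (k : fieldType) (N : nat) (G : sgraph N) d : ms_values k G d ->
  ms_values k G (ms k G) /\ (ms k G <= d)%N.
Proof.
move=> msd; suff [r rP] : [set r | ms_values k G r /\
    forall d, ms_values k G d -> (r <= d)%N] !=set0.
  (* Once a least value is known to exist, [xget] returns one and not its default 0. *)
  by have [ms_ms ms_le] := xgetI 0%N rP; split=> //; apply: ms_le.
have ex : exists r, `[< ms_values k G r >] by exists d; apply/asboolP.
case: (ex_minnP ex) => r /asboolP msr r_le; exists r; split=> // e mse.
by apply/r_le/asboolP.
Qed.

Lemma card_ord_interval (N a b : nat) : (b <= N)%N ->
  #|[set i : 'I_N | (a <= i < b)%N]%SET| = (b - a)%N.
Proof.
move=> leb; rewrite cardsE -sum1_card -[RHS]muln1 -sum_nat_const_nat.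
rewrite (big_nat_widen _ _ N) // big_geq_mkord.
by apply: eq_bigl => i; rewrite andbC.
Qed.

Theorem proposition6p50 (k : fieldType) (m n : nat)
    (hm : (2 <= m)%N) (hn : (2 <= n)%N) :
  (2 <= ms k (wedge_complete m n) <= minn m n)%N.
Proof.
have lt0 : (0 < m + n - 1)%N by lia.
have ltm : (m - 1 < m + n - 1)%N by lia.
have ltN : (m + n - 2 < m + n - 1)%N by lia.
(* The roles cross: the clique on n vertices leaves m - 1 vertices outside, so it gives the value m.
   The clique on m vertices then gives n. *)
have msm : ms_values k (wedge_complete m n) m.
  pose A := [set i : 'I_(m + n - 1) | (m - 1 <= i < m + n - 1)%N]%SET.
  have Em : (m + n - 1 - #|A|).+1 = m by rewrite card_ord_interval; lia.
  rewrite -[X in ms_values _ _ X]Em.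
  apply: (@clique_ms_values _ _ _ A (Ordinal ltm)) => [|i j].
    by rewrite inE /=; lia.
  rewrite !inE => /andP[iA _] /andP[jA _] ij.
  by rewrite /= /wedge_adj /complete_on /= ij iA jA orbT.
have msn : ms_values k (wedge_complete m n) n.
  pose A := [set i : 'I_(m + n - 1) | (0 <= i < m)%N]%SET.
  have En : (m + n - 1 - #|A|).+1 = n by rewrite card_ord_interval; lia.
  rewrite -[X in ms_values _ _ X]En.
  apply: (@clique_ms_values _ _ _ A (Ordinal lt0)) => [|i j].
    by rewrite inE /=; lia.
  rewrite !inE => /andP[_ iA] /andP[_ jA] ij.
  by rewrite /= /wedge_adj /complete_on /= ij iA jA.
have [msP le_m] := ms_min msm; have [_ le_n] := ms_min msn.
rewrite leq_min le_m le_n !andbT.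
(* The first and the last vertex both differ from the shared vertex m - 1, as m and n are at least
   2, so they lie in different cliques and are not adjacent. *)
apply: (@ms_values_ge2 _ _ _ (Ordinal lt0) (Ordinal ltN)) msP.
  by rewrite -val_eqE /=; lia.
by rewrite /= /wedge_adj /complete_on /=; lia.
Qed.
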